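(* Let $n>2$ and let $S=\{o_1,\dots,o_n\}$ be a set of $n$ distinct non-void OIE instances, and let $\alpha<\beta$ be reals, such that: (uniqueness) for any two distinct subsets $S_1\ne S_2$ of $S$ with at least two elements, every result of $\oplus|_\alpha^\beta$ on $S_1$ (in any operand order) differs from every result of $\oplus|_\alpha^\beta$ on $S_2$ (in any operand order); (non-degeneracy) for every subset $S_1\subseteq S$ with at least two elements and every operand order, the result of $\oplus|_\alpha^\beta$ on $S_1$ is not the void instance. Let $$P_\oplus(S)=\{[o_{\mathrm{void}}]_\sim\}\cup\{[o_i]_\sim:1\le i\le n\}\cup\bigcup_{k=2}^n\big\{[\oplus|_\alpha^\beta(o_{i_1},\dots,o_{i_k})]_\sim:\{i_1,\dots,i_k\}\subseteq\{1,\dots,n\},\ i_1,\dots,i_k\text{ distinct}\big\}.$$ Let $(P,\oslash)$ be the finite commutative semigroup with absorbing element $v_0$ and reflexive absorption property on $n$ generators $v_1,\dots,v_n$. Then $|P_\oplus(S)|=2^n=|P|$, and the map $\Psi:P\to P_\oplus(S)$ given by $\Psi(v_0)=[o_{\mathrm{void}}]_\sim$, $\Psi(v_i)=[o_i]_\sim$, and $\Psi(v_{i_1}\oslash\cdots\oslash v_{i_k})=[\oplus|_\alpha^\beta(o_{i_1},\dots,o_{i_k})]_\sim$ for distinct $i_1,\dots,i_k$ with $k\ge2$, is a bijection.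
   Context: The semigroup: $P=\{v_0\}\cup\{\oslash(G'):\emptyset\ne G'\subseteq G\}$ where $G=\{v_1,\dots,v_n\}$ is a set of $n$ distinct generators and $\oslash(\{v_{i_1},\dots,v_{i_k}\})=v_{i_1}\oslash\cdots\oslash v_{i_k}$. The binary operation $\oslash$ on $P$ is associative and commutative, $v\oslash v_0=v_0\oslash v=v_0$ and $v\oslash v=v_0$ for all $v\in P$; distinct nonempty subsets $G'\ne G''$ of $G$ satisfy $\oslash(G')\ne\oslash(G'')$; and $\oslash(G')\neq v_0$ for every $G'\subseteq G$ with $|G'|>1$. Times are real numbers; a ''2-tuple'' is a pair $(x,y)$ of reals with $x<y$. For a nonempty finite tuple of 2-tuples $T=((x_1,y_1),\dots,(x_m,y_m))$ put $\mathrm{bound}(T)=(\min_i x_i,\max_i y_i)$. An OIE (Optional Intervals Event) instance is a 4-tuple $o=(\mathcal C_o,\mathcal F_o,\mathcal I_o,\mathcal A_o)$ where $\mathcal C_o$ is a finite (possibly empty) tuple of OIE instances, $\mathcal F_o$ is a set of nonempty finite tuples of 2-tuples, $\mathcal I_o=\{\mathrm{bound}(T):T\in\mathcal F_o\}$, and $\mathcal A_o$ is a set of (labels of) atomic events. The void instance is $o_{\mathrm{void}}=((),\emptyset,\emptyset,\emptyset)$; every other instance has $\mathcal F_o,\mathcal I_o,\mathcal A_o$ nonempty. Two instances are equal iff all four components are equal. An index tuple of length $m$ is a tuple in which each of $1,\dots,m$ occurs exactly once. A permutation matrix $M$ acts on $m$-tuples (row vectors) on the right by reordering the entries, $T\mapsto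 T\cdot M$. For a finite set $S'=\{o'_1,\dots,o'_m\}$ of OIE instances and an index tuple $\sigma=(i_1,\dots,i_m)$, let $N(S',\sigma)=\{(t_1,\dots,t_m): t_k\in\mathcal I_{o'_{i_k}}\text{ for all }k\}$. External constraints determine an infeasible subset $\mathrm{Inf}(S',\sigma)\subseteq N(S',\sigma)$; this is given data, subject only to the standing axiom: whenever $\sigma\cdot M=\tau$ for index tuples $\sigma,\tau$ of length $m>1$ and a permutation matrix $M$, the map $T\mapsto T\cdot M$ is a bijection from $\mathrm{Inf}(S',\sigma)$ onto $\mathrm{Inf}(S',\tau)$. Put $\mathrm{Feas}(S',\sigma)=N(S',\sigma)\setminus\mathrm{Inf}(S',\sigma)$. Domain filter: for a nonempty set $X$ of $m$-tuples of 2-tuples and reals $\alpha<\beta$, let $X'=\{T\in X: x\ge\alpha\text{ and }y\le\beta\text{ for every entry }(x,y)\text{ of }T\}$. Then $\mathrm{Dom}_\alpha^\beta(X)=X'$ if for every $k\in\{1,\dots,m\}$ some $T\in X'$ has $k$-th entry with first item $\alpha$ and some $T\in X'$ has $k$-th entry with second item $\beta$; otherwise $\mathrm{Dom}_\alpha^\beta(X)=\emptyset$. Complete Sequence Addition $\oplus|_\alpha^\beta(o'_{i_1},\dots,o'_{i_m})$ ($m\ge2$, $\sigma=(i_1,\dots,i_m)$): the result is $o_{\mathrm{void}}$ if $\bigcap_{k}\mathcal A_{o'_{i_k}}\ne\emptyset$, or some $o'_{i_k}=o_{\mathrm{void}}$, or $\mathrm{Feas}(S',\sigma)=\emptyset$,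 or $\mathrm{Dom}_\alpha^\beta(\mathrm{Feas}(S',\sigma))=\emptyset$. Otherwise the result is $(\mathcal C,\mathcal F,\mathcal I,\mathcal A)$ with $\mathcal C=(o'_{i_1},\dots,o'_{i_m})$, $\mathcal F=\mathrm{Dom}_\alpha^\beta(\mathrm{Feas}(S',\sigma))$, $\mathcal I=\{\mathrm{bound}(T):T\in\mathcal F\}$, $\mathcal A=\bigcup_k\mathcal A_{o'_{i_k}}$. Permutational equivalence $\sim$: two non-void instances $o,o'$ satisfy $o\sim o'$ if there is a permutation matrix $M$ such that $\mathcal C_o\cdot M=\mathcal C_{o'}$, $T\mapsto T\cdot M$ is a bijection from $\mathcal F_o$ onto $\mathcal F_{o'}$, $\mathcal I_o=\mathcal I_{o'}$ and $\mathcal A_o=\mathcal A_{o'}$ (for atomic instances, those with $\mathcal C$ empty and $\mathcal F$ consisting of 1-tuples, $\sim$ is equality). By convention $o_{\mathrm{void}}\sim o_{\mathrm{void}}$, and $o_{\mathrm{void}}$ is equivalent to no non-void instance. $[o]_\sim$ is the equivalence class of $o$. *)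

(* Defs.v *)
From HB Require Import structures.
From mathcomp Require Import all_boot all_order all_algebra all_fingroup.
From mathcomp Require Import all_classical all_reals.

Set Implicit Arguments.
Unset Strict Implicit.
Unset Printing Implicit Defensive.

Import Order.TTheory GRing.Theory Num.Theory.

Local Open Scope classical_set_scope.
Local Open Scope ring_scope.

(* The action of a permutation matrix on a row vector of length m with entries
   in an arbitrary type: entry j of [T *m perm_mx M] is entry [M^-1 j] of T.
   Only meaningful when [size T = m]. *)
Definition mulperm (X : Type) (m : nat) (M : 'S_m) (T : seq X) : seq X :=
  pmap (fun j : 'I_m => onth T (M^-1%g j)) (enum 'I_m).

(* (min_i x_i, max_i y_i); only meaningful for nonempty T. *)
Definition bound (R : realType) (T : seq (R * R)) : R * R :=
  (\big[Order.min/(head (0, 0) T).1]_(t <- T) t.1,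
   \big[Order.max/(head (0, 0) T).2]_(t <- T) t.2).

(* Raw 4-tuples (C, F, I, A), with atomic events labelled in L; the OIE
   instances are those that satisfy [is_oie] below. *)
Inductive oie (R : realType) (L : Type) : Type := OIE {
  comps : seq (oie R L);
  tuples : set (seq (R * R));
  ints : set (R * R);
  atoms : set L
}.

HB.instance Definition _ (R : realType) (L : Type) := gen_eqMixin (oie R L).

Definition oie_void (R : realType) (L : Type) : oie R L :=
  OIE [::] set0 set0 set0.

Arguments oie_void {R L}.

Inductive is_oie (R : realType) (L : Type) : oie R L -> Prop :=
  IsOIE (o : oie R L) of
      (forall c, c \in comps o -> is_oie c)
    & (forall T, tuples o T ->
         T <> [::] /\ (forall t, t \in T -> t.1 < t.2))
    & ints o = [set bound T | T in tuples o]
    & (o <> oie_void ->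
         [/\ tuples o !=set0, ints o !=set0 & atoms o !=set0]) :
    is_oie o.

(* The disjunct [o = o'] gives [oie_void ~ oie_void], and equality on the
   instances where no permutation matrix acts simultaneously on C and on the
   elements of F, in particular on atomic instances (C empty, F consisting of
   1-tuples). On all other instances it is the case M = 1 of the second
   disjunct. *)
Definition perm_equiv (R : realType) (L : Type) (o o' : oie R L) : Prop :=
  o = o' \/
  [/\ o <> oie_void, o' <> oie_void &
    exists (m : nat) (M : 'S_m),
      [/\ size (comps o) = m /\ (forall T, tuples o T -> size T = m),
          mulperm M (comps o) = comps o',
          set_bij (tuples o) (tuples o') (mulperm M),
          ints o = ints o' &
          atoms o = atoms o']].

Definition perm_class (R : realType) (L : Type) (o : oie R L) :
    set (oie R L) :=
  [set o' | is_oie o' /\ perm_equiv o o'].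

(* A pair (S', sigma), with S' = {o'_1, ..., o'_m} and sigma = (i_1, ..., i_m)
   an index tuple, is encoded by the duplicate-free operand sequence
   s = (o'_(i_1), ..., o'_(i_m)); then sigma . M corresponds to
   [mulperm M s]. *)
Definition N_set (R : realType) (L : Type) (s : seq (oie R L)) :
    set (seq (R * R)) :=
  [set T | size T = size s /\
    forall k : nat, (k < size s)%N ->
      ints (nth oie_void s k) (nth (0, 0) T k)].

Record infeasibility (R : realType) (L : Type)
    (Inf : seq (oie R L) -> set (seq (R * R))) : Prop := {
  inf_sub : forall s : seq (oie R L),
    uniq s -> (forall o, o \in s -> is_oie o) -> Inf s `<=` N_set s;
  inf_perm : forall (m : nat) (M : 'S_m) (s : seq (oie R L)),
    (1 < m)%N -> size s = m ->
    uniq s -> (forall o, o \in s -> is_oie o) ->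
    set_bij (Inf s) (Inf (mulperm M s)) (mulperm M)
}.

Definition feas (R : realType) (L : Type)
    (Inf : seq (oie R L) -> set (seq (R * R))) (s : seq (oie R L)) :
    set (seq (R * R)) :=
  N_set s `\` Inf s.

(* The domain filter on a set X of m-tuples. *)
Definition dom (R : realType) (alpha beta : R) (m : nat)
    (X : set (seq (R * R))) : set (seq (R * R)) :=
  let X' :=
    [set T | X T /\ forall t, t \in T -> alpha <= t.1 /\ t.2 <= beta] in
  if `[< forall k : nat, (k < m)%N ->
           (exists2 T, X' T & (nth (0, 0) T k).1 = alpha) /\
           (exists2 T, X' T & (nth (0, 0) T k).2 = beta) >]
  then X' else set0.

(* Complete Sequence Addition, meant for [1 < size s]. *)
Definition oplus (R : realType) (L : Type)
    (Inf : seq (oie R L) -> set (seq (R * R))) (alpha beta : R)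
    (s : seq (oie R L)) : oie R L :=
  let D := dom alpha beta (size s) (feas Inf s) in
  if `[< [\/ \bigcap_(o in [set` s]) atoms o !=set0,
             oie_void \in s,
             feas Inf s = set0 |
             D = set0] >]
  then oie_void
  else OIE s D [set bound T | T in D] (\bigcup_(o in [set` s]) atoms o).

Definition P_oplus (R : realType) (L : Type)
    (Inf : seq (oie R L) -> set (seq (R * R))) (alpha beta : R)
    (n : nat) (o : 'I_n -> oie R L) : set (set (oie R L)) :=
  [set perm_class oie_void]
  `|` [set perm_class (o i) | i in [set: 'I_n]]
  `|` \bigcup_(k in [set k : nat | (2 <= k <= n)%N])
        [set perm_class (oplus Inf alpha beta (map o s)) |
           s in [set s : seq 'I_n | uniq s /\ size s = k]].

(* v_(i_1) op ... op v_(i_k), bracketed to the left; the empty sequence gets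
   the junk value v0. *)
Definition oslash (P : Type) (op : P -> P -> P) (v0 : P) (n : nat)
    (v : 'I_n -> P) (s : seq 'I_n) : P :=
  if s is i :: s' then foldl (fun x j => op x (v j)) (v i) s' else v0.

(* [v] enumerates the generators, so that sets of generators are given by
   sets of indices. *)
Record reflexive_absorption_semigroup (P : Type) (op : P -> P -> P) (v0 : P)
    (n : nat) (v : 'I_n -> P) : Prop := {
  ras_assoc : associative op;
  ras_comm : commutative op;
  ras_absorb_r : right_zero v0 op;
  ras_absorb_l : left_zero v0 op;
  ras_refl : forall x : P, op x x = v0;
  ras_gen_inj : injective v;
  ras_carrier : forall x : P,
    x = v0 \/ exists2 G : {set 'I_n}, G != finset.set0 &
                x = oslash op v0 v (enum G);
  ras_distinct : forall G G' : {set 'I_n},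
    G != finset.set0 -> G' != finset.set0 -> G != G' ->
    oslash op v0 v (enum G) <> oslash op v0 v (enum G');
  ras_nonzero : forall G : {set 'I_n},
    (1 < #|G|)%N -> oslash op v0 v (enum G) <> v0
}.

Record is_Psi (R : realType) (L : Type)
    (Inf : seq (oie R L) -> set (seq (R * R))) (alpha beta : R)
    (n : nat) (o : 'I_n -> oie R L)
    (P : Type) (op : P -> P -> P) (v0 : P) (v : 'I_n -> P)
    (Psi : P -> set (oie R L)) : Prop := {
  Psi_zero : Psi v0 = perm_class oie_void;
  Psi_gen : forall i : 'I_n, Psi (v i) = perm_class (o i);
  Psi_op : forall s : seq 'I_n, uniq s -> (2 <= size s)%N ->
    Psi (oslash op v0 v s) = perm_class (oplus Inf alpha beta (map o s))
}.

(* Main.v *)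
Require Import Defs.
From HB Require Import structures.
From mathcomp Require Import all_boot all_order all_algebra all_fingroup.
From mathcomp Require Import all_classical all_reals.

Set Implicit Arguments.
Unset Strict Implicit.
Unset Printing Implicit Defensive.

Import Order.TTheory GRing.Theory Num.Theory.

Local Open Scope classical_set_scope.
Local Open Scope ring_scope.

(** Both [P] and [P_oplus] are indexed by the subsets [G] of ['I_n]: the empty
    set stands for the zero, a singleton for a generator, and a larger set for
    the sum of its members. [Psi] carries the element indexed by [G] to the
    class indexed by [G], so the theorem amounts to both indexings being
    bijective.

    For [P] this is read off the axioms ([oslash_enum_bij]); the one point to
    see is that no generator is the zero, since a product of two distinct
    generators is not the zero.

    For [P_oplus] there are two points. The class of a sum does not depend on
    the order of the operands ([perm_equiv_oplus]): reordering them by a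
    permutation matrix reorders all feasible tuples by the same matrix, because
    the constraints and the domain filter are equivariant, while bounds and
    unions of atoms are symmetric. And distinct subsets have distinct classes
    ([subset_class_inj]): the sum of two distinct [o i] and [o j] is not void,
    hence their sets of atoms are disjoint ([atoms_disjoint]); equivalent
    instances have the same atoms, and the atoms of the sum over [G] are the
    disjoint union of the nonempty sets [atoms (o i)] for [i] in [G], from which
    [G] is recovered. *)

(** * The action of permutation matrices on sequences *)

Lemma mulpermE (X : Type) (x0 : X) (m : nat) (M : 'S_m) (T : seq X) :
  size T = m ->
  mulperm M T = [seq nth x0 T (M^-1%g j) | j <- enum 'I_m].
Proof.
move=> sT; rewrite /mulperm; elim: (enum 'I_m) => //= j r ->.
by rewrite onthE (nth_map x0) ?sT.
Qed.

Lemma size_mulperm (X : Type) (m : nat) (M : 'S_m) (T : seq X) :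
  size T = m -> size (mulperm M T) = m.
Proof.
case: T => [|x0 T'] sT; last by rewrite (mulpermE x0) // size_map size_enum_ord.
by case: m / sT M => M; rewrite /mulperm (size0nil (size_enum_ord 0)).
Qed.

Lemma nth_mulperm (X : Type) (x0 : X) (m : nat) (M : 'S_m) (T : seq X)
    (j : 'I_m) :
  size T = m -> nth x0 (mulperm M T) j = nth x0 T (M^-1%g j).
Proof.
by move=> sT; rewrite (mulpermE x0) // (nth_map j) ?size_enum_ord // nth_ord_enum.
Qed.

(** The default [x0] is quantified because [X] may be empty. *)
Lemma mulperm_eqP (X : Type) (m : nat) (T U : seq X) :
  size T = m -> size U = m ->
  (forall x0 (j : 'I_m), nth x0 T j = nth x0 U j) -> T = U.
Proof.
case: T => [|x0 T] sT sU E; first by rewrite [U]size0nil // sU -sT.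
apply: (@eq_from_nth _ x0); rewrite sT ?sU // => i lti.
exact: (E x0 (Ordinal lti)).
Qed.

Lemma mulpermM (X : Type) (m : nat) (M1 M2 : 'S_m) (T : seq X) :
  size T = m -> mulperm M2 (mulperm M1 T) = mulperm (M1 * M2)%g T.
Proof.
move=> sT; apply: (@mulperm_eqP _ m); rewrite ?size_mulperm // => x0 j.
by rewrite !nth_mulperm ?size_mulperm // invMg permM.
Qed.

Lemma mulperm1 (X : Type) (m : nat) (T : seq X) :
  size T = m -> mulperm (1%g : 'S_m) T = T.
Proof.
move=> sT; apply: (@mulperm_eqP _ m); rewrite ?size_mulperm // => x0 j.
by rewrite nth_mulperm // invg1 perm1.
Qed.

Lemma mulpermK (X : Type) (m : nat) (M : 'S_m) (T : seq X) :
  size T = m -> mulperm M^-1%g (mulperm M T) = T.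
Proof. by move=> sT; rewrite mulpermM // mulgV mulperm1. Qed.

Lemma mulpermVK (X : Type) (m : nat) (M : 'S_m) (T : seq X) :
  size T = m -> mulperm M (mulperm M^-1%g T) = T.
Proof. by move=> sT; rewrite mulpermM // mulVg mulperm1. Qed.

Lemma perm_mulperm (X : eqType) (m : nat) (M : 'S_m) (T : seq X) :
  size T = m -> perm_eq (mulperm M T) T.
Proof.
move=> sT; have sTb : size T == m by apply/eqP.
apply/(@tuple_permP _ _ _ (Tuple sTb)); exists M^-1%g.
apply: (@mulperm_eqP _ m); rewrite ?size_mulperm ?size_tuple // => x0 j.
by rewrite nth_mulperm // -tnth_nth tnth_mktuple (tnth_nth x0).
Qed.

Lemma perm_eq_mulperm (X : eqType) (T U : seq X) :
  perm_eq T U -> exists M : 'S_(size T), U = mulperm M T.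
Proof.
rewrite perm_sym => /(@tuple_permP _ _ _ (in_tuple T)) [p EU]; exists p^-1%g.
have sU : size U = size T by rewrite EU size_tuple.
apply: (@mulperm_eqP _ (size T)); rewrite ?size_mulperm // => x0 j.
by rewrite nth_mulperm // invgK EU -tnth_nth tnth_mktuple (tnth_nth x0).
Qed.

(** Since the action is invertible on sequences of size [m], bijectivity is a
    pointwise equivalence; this form is stable under set difference and under
    the domain filter. *)
Lemma set_bij_mulpermP (X : Type) (m : nat) (M : 'S_m) (A B : set (seq X)) :
  (forall T, A T -> size T = m) ->
  set_bij A B (mulperm M) <->
  (forall T, B T -> size T = m) /\
  (forall T, size T = m -> (A T <-> B (mulperm M T))).
Proof.
move=> sA; split=> [[fAB _ sAB]|[sB AB]].
  split=> [T /sAB [U AU <-]|T sT]; first by rewrite size_mulperm ?sA.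
  split=> [|/sAB [U AU EU]]; first exact: fAB.
  by rewrite -(mulpermK M sT) -EU mulpermK ?sA.
split=> [T AT|T U /set_mem AT /set_mem AU E|T BT].
- by apply/AB => //; exact: sA.
- by rewrite -(mulpermK M (sA _ AT)) E mulpermK ?sA.
- exists (mulperm M^-1%g T); last by rewrite mulpermVK ?sB.
  by apply/AB; rewrite ?size_mulperm ?mulpermVK ?sB.
Qed.

(** * Bounds of tuples *)

Section Bounds.
Variable R : realType.
Implicit Types T U : seq (R * R).

Lemma bound_le T U : T <> [::] -> {subset T <= U} ->
  (bound U).1 <= (bound T).1 /\ (bound T).2 <= (bound U).2.
Proof.
case: T => // t0 T _ TU; split=> /=.
  rewrite [leRHS]big_seq; apply: le_bigmin => [|t tT].
    by apply: (ge_bigmin_seq _ _ _ (fun t : R * R => t.1)) => //; exact: TU (mem_head _ _).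
  by apply: (ge_bigmin_seq _ _ _ (fun t : R * R => t.1)) => //; exact: TU.
rewrite [leLHS]big_seq; apply: bigmax_le => [|t tT].
  by apply: (le_bigmax_seq _ _ _ (fun t : R * R => t.2)) => //; exact: TU (mem_head _ _).
by apply: (le_bigmax_seq _ _ _ (fun t : R * R => t.2)) => //; exact: TU.
Qed.

Lemma bound_perm T U : T <> [::] -> perm_eq T U -> bound T = bound U.
Proof.
move=> T0 TU; have U0 : U <> [::].
  by move=> U0; move: TU; rewrite U0 => /perm_size /size0nil.
have sTU : {subset T <= U} by move=> x; rewrite (perm_mem TU).
have sUT : {subset U <= T} by move=> x; rewrite (perm_mem TU).
have [l1 l2] := bound_le T0 sTU; have [l3 l4] := bound_le U0 sUT.
by rewrite [bound T]surjective_pairing [bound U]surjective_pairing;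
  congr (_, _); apply/le_anti/andP.
Qed.

Lemma bound_lt T : T <> [::] -> (forall t, t \in T -> t.1 < t.2) ->
  (bound T).1 < (bound T).2.
Proof.
case: T => // t T _ lt; have tT : t \in t :: T by exact: mem_head.
have [||l1 l2] := @bound_le [:: t] (t :: T); rewrite //.
  by move=> x; rewrite inE => /eqP ->.
apply: (le_lt_trans l1); apply: (lt_le_trans _ l2).
by rewrite /bound /= !big_cons !big_nil minxx maxxx lt.
Qed.
End Bounds.

(** * Permutational equivalence *)

Section Instances.
Variables (R : realType) (L : Type).
Implicit Types (x y z : oie R L) (s : seq (oie R L)).

Lemma perm_equiv_sym x y : perm_equiv x y -> perm_equiv y x.
Proof.
case=> [->|[x0 y0 [m [M [[sx sF] EC bF EI EA]]]]]; first by left.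
have [sF' FF'] := (set_bij_mulpermP M _ sF).1 bF.
right; split=> //; exists m, M^-1%g; split=> //; first by rewrite -EC size_mulperm.
  by rewrite -EC mulpermK.
apply/set_bij_mulpermP => //; split=> // T sT.
by rewrite FF' ?size_mulperm // mulpermVK.
Qed.

Lemma perm_equiv_trans x y z : perm_equiv x y -> perm_equiv y z -> perm_equiv x z.
Proof.
case=> [->//|[x0 y0 [m [M [[sx sF] EC bF EI EA]]]]].
case=> [<-|[_ z0 [m' [M' [[sy sG] EC' bG EI' EA']]]]].
  by right; split=> //; exists m, M.
have Em : m = m' by rewrite -sy -EC size_mulperm.
(* Both matrices must act on the same number of entries to be multiplied. *)
case: m' / Em in M' sy sG EC' bG *; right; split=> //; exists m, (M * M')%g; split=> //.
- by rewrite -mulpermM // EC.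
- have [sG' FG] := (set_bij_mulpermP M _ sF).1 bF.
  have [sH GH] := (set_bij_mulpermP M' _ sG).1 bG.
  apply/set_bij_mulpermP => //; split=> // T sT.
  by rewrite FG // GH ?size_mulperm // mulpermM.
- by rewrite EI.
- by rewrite EA.
Qed.

Lemma perm_equiv_atoms x y : perm_equiv x y -> atoms x = atoms y.
Proof. by case=> [->|[_ _ [m [M []]]]]. Qed.

Lemma perm_class_eq x y : perm_equiv x y -> perm_class x = perm_class y.
Proof.
move=> xy; apply/seteqP; split=> z [oz e]; split=> //.
  exact: perm_equiv_trans (perm_equiv_sym xy) e.
exact: perm_equiv_trans xy e.
Qed.

(** A class only contains instances satisfying [is_oie], so [y] has to be one
    for its class to contain it. *)
Lemma perm_class_atoms x y :
  is_oie y -> perm_class x = perm_class y -> atoms x = atoms y.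
Proof.
move=> oy Exy; have : perm_class y y by split=> //; left.
by rewrite -Exy => -[_ /perm_equiv_atoms].
Qed.

Lemma is_oie_void : is_oie (@oie_void R L).
Proof. by constructor=> //; rewrite image_set0. Qed.

Lemma atoms_nonempty x : is_oie x -> x <> oie_void -> atoms x !=set0.
Proof. by case=> {}x _ _ _ h /h []. Qed.

(** * Complete sequence addition and reordering of the operands *)

Section Sums.
Variables (Inf : seq (oie R L) -> set (seq (R * R))) (alpha beta : R).

Lemma feas_size s T : feas Inf s T -> size T = size s.
Proof. by case=> -[]. Qed.

Lemma dom_sub m X T : Defs.dom alpha beta m X T -> X T.
Proof. by rewrite /Defs.dom; case: ifP => // _ []. Qed.

Lemma oplus_nonvoidE s : oplus Inf alpha beta s <> oie_void ->
  let D := Defs.dom alpha beta (size s) (feas Inf s) in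
  [/\ oplus Inf alpha beta s =
        OIE s D [set bound T | T in D] (\bigcup_(x in [set` s]) atoms x),
      \bigcap_(x in [set` s]) atoms x = set0, oie_void \notin s & D !=set0].
Proof.
rewrite /oplus /=; case: asboolP => // nh _; split=> //.
- apply: contra_notP nh => /eqP/set0P h; exact: Or41.
- by apply/negP => h; apply: nh; exact: Or42.
- by apply/set0P/eqP => h; apply: nh; exact: Or44.
Qed.

(** The entries of the tuples of a sum are bounds of tuples of the operands,
    hence proper intervals. *)
Lemma is_oie_oplus s : (1 < size s)%N -> (forall x, x \in s -> is_oie x) ->
  is_oie (oplus Inf alpha beta s).
Proof.
move=> s1 os; have [->|/eqP nv] := eqVneq (oplus Inf alpha beta s) oie_void.
  exact: is_oie_void.
have [-> _ v0 D0] := oplus_nonvoidE nv.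
constructor=> //= [T /dom_sub [[sT NT] _]|_].
  split=> [T0|t /(nthP (0, 0)) [k]]; first by move: s1; rewrite -sT T0.
  rewrite sT => ks <-; have xs := mem_nth oie_void ks; have := NT k ks.
  case: (os _ xs) => x _ hF -> _ [U /hF [U0 hU] <-]; exact: bound_lt.
have [x xs] : exists x, x \in s.
  by case: s s1 {os nv v0 D0} => // x s _; exists x; exact: mem_head.
have [|a xa] := atoms_nonempty (os x xs).
  by move=> E; move: v0; rewrite -E xs.
split=> //; last by exists a, x.
by have [T DT] := D0; exists (bound T), T.
Qed.

(** Position [k] of the reordered tuples is position [M^-1 k] of the original
    ones, so the condition of the filter, which ranges over all positions, is
    inherited. The name [dom] is qualified because the domain of a group
    morphism bears it too. *)
Lemma dom_mulperm_sub m (M : 'S_m) X Y T :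
  (forall U, X U -> size U = m) ->
  (forall U, X U -> Y (mulperm M U)) ->
  Defs.dom alpha beta m X T -> Defs.dom alpha beta m Y (mulperm M T).
Proof.
move=> sX XY; rewrite /Defs.dom.
set X' := [set T | X T /\ _]; set Y' := [set T | Y T /\ _].
have X'Y' U : X' U -> Y' (mulperm M U).
  case=> XU hU; split=> [|t]; first exact: XY.
  by rewrite (perm_mem (perm_mulperm M (sX _ XU))) => /hU.
case: asboolP => // hX X'T; case: asboolP => [_|]; first exact: X'Y'.
case=> k km; have [[U XU EU] [V XV EV]] := hX (M^-1%g (Ordinal km)) (ltn_ord _).
split.
  exists (mulperm M U); first exact: X'Y'.
  by rewrite (nth_mulperm _ _ (Ordinal km)) // (sX _ XU.1).
exists (mulperm M V); first exact: X'Y'.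
by rewrite (nth_mulperm _ _ (Ordinal km)) // (sX _ XV.1).
Qed.

(** The converse inclusion is [dom_mulperm_sub] for the inverse permutation. *)
Lemma dom_mulperm m (M : 'S_m) X Y T :
  (forall U, X U -> size U = m) -> (forall U, Y U -> size U = m) ->
  (forall U, size U = m -> (X U <-> Y (mulperm M U))) -> size T = m ->
  Defs.dom alpha beta m X T <-> Defs.dom alpha beta m Y (mulperm M T).
Proof.
move=> sX sY XY sT; split.
  by apply: dom_mulperm_sub => // U XU; apply/XY => //; exact: sX.
rewrite -{2}(mulpermK M sT); apply: dom_mulperm_sub => // U YU.
by apply/XY; rewrite ?size_mulperm ?mulpermVK ?sY.
Qed.

Lemma N_set_mulperm m (M : 'S_m) s T : size s = m -> size T = m ->
  N_set s T <-> N_set (mulperm M s) (mulperm M T).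
Proof.
move=> ss sT; rewrite /N_set /= !size_mulperm // ss; split=> -[_ h]; split=> // k km.
  by rewrite !(nth_mulperm _ _ (Ordinal km)) //; exact: h.
have := h (M (Ordinal km)) (ltn_ord _).
by rewrite !nth_mulperm // permK.
Qed.

Hypothesis hInf : infeasibility Inf.

Lemma feas_mulperm m (M : 'S_m) s T :
  (1 < m)%N -> size s = m -> size T = m ->
  uniq s -> (forall x, x \in s -> is_oie x) ->
  feas Inf s T <-> feas Inf (mulperm M s) (mulperm M T).
Proof.
move=> m1 ss sT us os; have sI U : Inf s U -> size U = m.
  by move=> /(inf_sub hInf us os) []; rewrite ss.
have [_ II] := (set_bij_mulpermP M _ sI).1 (inf_perm hInf M m1 ss us os).
by rewrite /feas /= /setD /= -N_set_mulperm // -II.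
Qed.

(** The matrix that reorders [s] into [s'] witnesses the equivalence: it carries
    the interval tuples [N_set], the infeasible tuples, and therefore the
    feasible tuples and their filtered part, from one order to the other. *)
Lemma perm_equiv_oplus s s' :
  (1 < size s)%N -> uniq s -> (forall x, x \in s -> is_oie x) ->
  oplus Inf alpha beta s <> oie_void -> oplus Inf alpha beta s' <> oie_void ->
  perm_eq s s' ->
  perm_equiv (oplus Inf alpha beta s) (oplus Inf alpha beta s').
Proof.
move=> s1 us os nv nv' ss'; have sz := perm_size ss'.
have [M Es'] := perm_eq_mulperm ss'.
right; split=> //; exists (size s), M.
have [-> _ _ _] := oplus_nonvoidE nv; have [-> _ _ _] := oplus_nonvoidE nv'.
rewrite -sz /=; set D := Defs.dom _ _ _ _; set D' := Defs.dom _ _ _ _.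
have sD T : D T -> size T = size s by move=> /dom_sub/feas_size.
have sD' T : D' T -> size T = size s by move=> /dom_sub/feas_size ->.
have DD' T : size T = size s -> (D T <-> D' (mulperm M T)).
  move=> sT; apply: dom_mulperm => // [U /feas_size//|U /feas_size ->//|U sU].
  by rewrite Es'; exact: feas_mulperm.
have D0 T : size T = size s -> T <> [::].
  by move=> sT T0; move: s1; rewrite -sT T0.
split=> //.
- by apply/set_bij_mulpermP.
- apply/seteqP; split=> _ [T DT <-].
    exists (mulperm M T); first exact/DD'/DT/sD.
    have sT := sD _ DT; apply/esym/bound_perm; first exact: D0.
    by rewrite perm_sym perm_mulperm.
  have sT := sD' _ DT; exists (mulperm M^-1%g T).
    by apply/DD'; rewrite ?size_mulperm ?mulpermVK.
  apply/esym/bound_perm; first exact: D0.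
  by rewrite perm_sym perm_mulperm.
- by congr (\bigcup_(x in _) _); apply/seteqP; split=> x /=; rewrite (perm_mem ss').
Qed.

End Sums.
End Instances.

(** * Enumerations and cardinals of finite types *)

Lemma perm_enum_set (T : finType) (s : seq T) :
  uniq s -> perm_eq s (enum [set x in s]).
Proof.
move=> us; apply: uniq_perm => // [|x]; first exact: enum_uniq.
by rewrite mem_enum inE.
Qed.

Lemma card_set_of_seq (T : finType) (s : seq T) :
  uniq s -> #|[set x in s]| = size s.
Proof. by move=> us; rewrite cardE -(perm_size (perm_enum_set us)). Qed.

Lemma set_bij_finType_card (T : finType) (U : Type) (A : set U) (f : T -> U) :
  set_bij [set: T] A f -> (A #= `I_#|T|)%card.
Proof.
have card_bij V (B : set V) (g : T -> V) : set_bij [set: T] B g ->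
    (B #= [set: T])%card.
  case=> gB gi gs.
  have -> : B = g @` [set: T].
    by apply/seteqP; split=> // _ [x _ <-]; exact: gB.
  exact: inj_card_eq.
move=> fB; apply: card_eq_trans (card_bij _ _ _ fB) _; rewrite card_eq_sym.
apply: (@card_bij _ _ (fun x => nat_of_ord (enum_rank x))); split=> [x _|x y _ _|k kT] /=.
- exact: ltn_ord.
- by move/val_inj/enum_rank_inj.
- by exists (enum_val (Ordinal kT)) => //; rewrite enum_valK.
Qed.

(** * Elements of the semigroup as subsets of generators *)

Section Semigroup.
Variables (P : Type) (op : P -> P -> P) (v0 : P) (n : nat) (v : 'I_n -> P).

(** A left-bracketed product of a nonempty sequence is a big operator for the
    commutative monoid obtained by adjoining a unit [None] to [P]. *)
Lemma oslash_perm (opA : associative op) (opC : commutative op) s s' :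
  perm_eq s s' -> oslash op v0 v s = oslash op v0 v s'.
Proof.
have foldlE x r : Some (foldl (fun x j => op x (v j)) x r) =
    oAC opA opC (Some x) (\big[oAC opA opC/None]_(j <- r) Some (v j)).
  elim: r x => [|j r IH] x /=; first by rewrite big_nil Monoid.mulm1.
  rewrite IH big_cons -(oACE opA opC) /=; by rewrite Monoid.mulmA.
have oslashE r : r <> [::] -> Some (oslash op v0 v r) =
    \big[oAC opA opC/None]_(j <- r) Some (v j).
  by case: r => // j r _; rewrite /= foldlE big_cons.
case: s s' => [|i s] [|i' s'] //; try by move=> /perm_size.
by move=> ss'; apply: Some_inj; rewrite !oslashE // (perm_big _ ss').
Qed.

Hypothesis hP : reflexive_absorption_semigroup op v0 v.

Lemma oslash_enum (s : seq 'I_n) : uniq s ->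
  oslash op v0 v s = oslash op v0 v (enum [set i in s]).
Proof.
move=> us; apply: oslash_perm (perm_enum_set us).
  exact: ras_assoc hP.
exact: ras_comm hP.
Qed.

(** If [v i] were the absorbing element, so would be its product with any other
    generator. *)
Lemma gen_neq_zero (i : 'I_n) : (1 < n)%N -> v i <> v0.
Proof.
move=> n1 vi0.
have [j ji] : exists j : 'I_n, j != i.
  have /card_gt0P [j] : (0 < #|[set~ i]%SET|)%N.
    by rewrite cardsC1 card_ord -subn1 subn_gt0.
  by rewrite !inE => ji; exists j.
have u2 : uniq [:: i; j] by rewrite /= inE eq_sym ji.
apply: (ras_nonzero hP (G := [set k in [:: i; j]])).
  by rewrite card_set_of_seq.
by rewrite -oslash_enum //= vi0 (ras_absorb_l hP).
Qed.

(** The empty subset is sent to [v0] by the default value of [oslash]. *)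
Lemma oslash_enum_bij : (1 < n)%N ->
  set_bij [set: {set 'I_n}] [set: P]
    (fun G : {set 'I_n} => oslash op v0 v (enum G)).
Proof.
move=> n1.
have nz (G : {set 'I_n}) : G != finset.set0 -> oslash op v0 v (enum G) <> v0.
  move=> G0; have [G1|] := ltnP 1 #|G|; first exact: ras_nonzero.
  rewrite leq_eqVlt ltnS leqn0 cards_eq0 (negPf G0) orbF => /cards1P [i ->].
  by rewrite enum_set1 /=; exact: gen_neq_zero.
split=> // [G G' _ _ /= E|x _].
  apply/eqP/negPn/negP => GG'.
  have [G0|G0] := eqVneq G finset.set0; have [G'0|G'0] := eqVneq G' finset.set0.
  - by rewrite G0 G'0 eqxx in GG'.
  - by apply: (nz _ G'0); rewrite -E G0 enum_set0.
  - by apply: (nz _ G0); rewrite E G'0 enum_set0.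
  - exact: ras_distinct hP _ _ G0 G'0 GG' E.
have [->|[G _ ->]] := ras_carrier hP x; last by exists G.
by exists finset.set0 => //; rewrite enum_set0.
Qed.

End Semigroup.

(** * Classes of sums as subsets of operands *)

(** Extends [oplus] to sequences of fewer than two operands in the way in which
    [P_oplus] indexes classes: void for none, the operand itself for one. *)
Definition seq_sum (R : realType) (L : Type)
    (Inf : seq (oie R L) -> set (seq (R * R))) (alpha beta : R)
    (s : seq (oie R L)) : oie R L :=
  match s with
  | [::] => oie_void
  | [:: x] => x
  | _ => oplus Inf alpha beta s
  end.

Section SubsetClasses.
Variables (R : realType) (L : Type).
Variables (Inf : seq (oie R L) -> set (seq (R * R))) (hInf : infeasibility Inf).
Variables (n : nat) (o : 'I_n -> oie R L).
Hypothesis ho_oie : forall i, is_oie (o i).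
Hypothesis ho_nonvoid : forall i, o i <> oie_void.
Hypothesis ho_inj : injective o.
Variables alpha beta : R.
Hypothesis oplus_nonvoid : forall s : seq 'I_n, uniq s -> (1 < size s)%N ->
  oplus Inf alpha beta (map o s) <> oie_void.

Definition subset_class (G : {set 'I_n}) : set (oie R L) :=
  perm_class (seq_sum Inf alpha beta (map o (enum G))).

(** The order of summation chosen by [enum] is immaterial. *)
Lemma subset_class_seq (s : seq 'I_n) : uniq s ->
  perm_class (seq_sum Inf alpha beta (map o s)) = subset_class [set i in s].
Proof.
move=> us; rewrite /subset_class.
have us' := enum_uniq [set i in s]; have ss' := perm_enum_set us.
apply: perm_class_eq; have sz := perm_size ss'.
have [s1|s1] := ltnP 1 (size s); last first.
  suff -> : enum [set i in s] = s by left.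
  case: s s1 us ss' sz {us'} => [|i [|//]] _ _.
    by move=> _ /esym/size0nil.
  by rewrite perm_sym => /perm_small_eq ->.
have sumE r : (1 < size r)%N ->
    seq_sum Inf alpha beta (map o r) = oplus Inf alpha beta (map o r).
  by case: r => [|i [|j r]].
have s1' : (1 < size (enum [set i in s]))%N by rewrite -sz.
rewrite (sumE _ s1) (sumE _ s1'); apply: (perm_equiv_oplus hInf).
- by rewrite size_map.
- by rewrite map_inj_uniq.
- by move=> _ /mapP [i _ ->].
- exact: oplus_nonvoid.
- exact: oplus_nonvoid.
- exact: perm_map.
Qed.

(** A common atom of two operands would make their sum void. *)
Lemma atoms_disjoint i j a : atoms (o i) a -> atoms (o j) a -> i = j.
Proof.
move=> ai aj; apply/eqP/negPn/negP => ij.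
have u2 : uniq [:: i; j] by rewrite /= inE ij.
have [_ I0 _ _] := oplus_nonvoidE (oplus_nonvoid u2 isT).
suff : set0 a by [].
by rewrite -I0 => x /=; rewrite !inE => /orP [] /eqP ->.
Qed.

Lemma is_oie_seq_sum (s : seq 'I_n) : is_oie (seq_sum Inf alpha beta (map o s)).
Proof.
case: s => [|i [|j s]]; [exact: is_oie_void|exact: ho_oie|].
apply: (@is_oie_oplus _ _ Inf alpha beta (map o [:: i, j & s])).
  by rewrite size_map.
by move=> x /mapP [k _ ->].
Qed.

Lemma atoms_seq_sum (s : seq 'I_n) : uniq s ->
  atoms (seq_sum Inf alpha beta (map o s)) = \bigcup_(i in [set` s]) atoms (o i).
Proof.
case: s => [|i [|j s]] us.
- by apply/seteqP; split=> a // [].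
- apply/seteqP; split=> a /=; first by exists i => //=; rewrite inE.
  by case=> k /=; rewrite inE => /eqP ->.
- rewrite -[seq_sum _ _ _ _]/(oplus Inf alpha beta (map o [:: i, j & s])).
  have [-> _ _ _] := oplus_nonvoidE (oplus_nonvoid us isT).
  apply/seteqP; split=> a [x].
    by move=> /mapP [k ks ->] ak; exists k.
  by move=> xs ax; exists (o x) => //; apply/mapP; exists x.
Qed.

(** Equal classes have equal atoms, and an atom of [o i] in the sum over [G']
    can only come from [o i] itself. *)
Lemma subset_class_inj : injective subset_class.
Proof.
have sub (G G' : {set 'I_n}) : subset_class G = subset_class G' -> G \subset G'.
  move=> /(perm_class_atoms (is_oie_seq_sum _)); rewrite !atoms_seq_sum ?enum_uniq // => E.
  apply/fintype.subsetP => i iG; have [a ai] := atoms_nonempty (ho_oie i) (@ho_nonvoid i).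
  have : (\bigcup_(j in [set` enum G]) atoms (o j)) a.
    by exists i => //=; rewrite mem_enum.
  rewrite E => -[j /=]; rewrite mem_enum => jG' aj.
  by rewrite (atoms_disjoint ai aj).
by move=> G G' E; apply/eqP; rewrite finset.eqEsubset !sub.
Qed.

Lemma subset_class_bij :
  set_bij [set: {set 'I_n}] (P_oplus Inf alpha beta o) subset_class.
Proof.
split=> [G _|G G' _ _|X].
- rewrite /subset_class; have := enum_uniq G; case: (enum G) => [|i [|j s]] us.
  + by left; left.
  + by left; right; exists i.
  + right; exists (size [:: i, j & s]); last by exists [:: i, j & s].
    by rewrite -(card_uniqP us) /= (leq_trans (max_card _)) ?card_ord // andbT
      (card_uniqP us).
- exact: subset_class_inj.
- case=> [[->|[i _ <-]]|[k /= /andP [k2 _] [s [us sk] <-]]].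
  + by exists finset.set0 => //; rewrite /subset_class enum_set0.
  + by exists [set i]%SET => //; rewrite /subset_class enum_set1.
  + exists [set i in s] => //; rewrite -subset_class_seq //.
    by case: s us sk => [|i [|j s]] // _ sk; rewrite -sk in k2.
Qed.

End SubsetClasses.

Theorem mainTheorem12 (R : realType) (L : Type)
    (Inf : seq (oie R L) -> set (seq (R * R)))
    (hInf : infeasibility Inf)
    (n : nat) (hn : (2 < n)%N)
    (o : 'I_n -> oie R L)
    (ho_oie : forall i, is_oie (o i))
    (ho_nonvoid : forall i, o i <> oie_void)
    (ho_inj : injective o)
    (alpha beta : R) (hab : alpha < beta)
    (uniqueness : forall (S1 S2 : {set 'I_n}) (s1 s2 : seq 'I_n),
       S1 != S2 -> (2 <= #|S1|)%N -> (2 <= #|S2|)%N ->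
       perm_eq s1 (enum S1) -> perm_eq s2 (enum S2) ->
       oplus Inf alpha beta (map o s1) <> oplus Inf alpha beta (map o s2))
    (nondegeneracy : forall (S1 : {set 'I_n}) (s1 : seq 'I_n),
       (2 <= #|S1|)%N -> perm_eq s1 (enum S1) ->
       oplus Inf alpha beta (map o s1) <> oie_void)
    (P : Type) (op : P -> P -> P) (v0 : P) (v : 'I_n -> P)
    (hP : reflexive_absorption_semigroup op v0 v) :
  [/\ (P_oplus Inf alpha beta o #= `I_(2 ^ n)%N)%card,
      ([set: P] #= `I_(2 ^ n)%N)%card,
      exists! Psi : P -> set (oie R L), is_Psi Inf alpha beta o op v0 v Psi &
      forall Psi : P -> set (oie R L), is_Psi Inf alpha beta o op v0 v Psi ->
        set_bij [set: P] (P_oplus Inf alpha beta o) Psi].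
Proof.
have n1 : (1 < n)%N by exact: ltnW.
have nv (s : seq 'I_n) : uniq s -> (1 < size s)%N ->
    oplus Inf alpha beta (map o s) <> oie_void.
  move=> us s1; apply: (nondegeneracy [set i in s]); last exact: perm_enum_set.
  by rewrite card_set_of_seq.
pose elt (G : {set 'I_n}) := oslash op v0 v (enum G).
pose cls := subset_class Inf o alpha beta.
have eltB : set_bij [set: {set 'I_n}] [set: P] elt := oslash_enum_bij hP n1.
have clsB : set_bij [set: {set 'I_n}] (P_oplus Inf alpha beta o) cls.
  exact: subset_class_bij.
have card2 : #|{set 'I_n}| = (2 ^ n)%N.
  by rewrite -cardsT -powersetT card_powerset cardsT card_ord.
(* The three equations of [is_Psi] are one equation over all subsets, the cases
   being those of an empty, a singleton, and a larger subset. *)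
have PsiP Psi : is_Psi Inf alpha beta o op v0 v Psi <->
    forall G : {set 'I_n}, Psi (elt G) = cls G.
  split=> [[P0 P1 P2] G|PE].
    rewrite /elt /cls /subset_class; have := enum_uniq G.
    case: (enum G) => [|i [|j s]] us; [exact: P0|exact: P1|exact: P2].
  split=> [|i|s us s2].
  - have := PE finset.set0.
    by rewrite /elt /cls /subset_class enum_set0.
  - have := PE [set i]%SET; by rewrite /elt /cls /subset_class enum_set1.
  - rewrite (oslash_enum hP us) [LHS]PE /cls -subset_class_seq //.
    by case: s us s2 => [|i [|j s]].
split.
- by rewrite -card2; exact: set_bij_finType_card clsB.
- by rewrite -card2; exact: set_bij_finType_card eltB.
- have [dec eltK decK] : bijective elt by rewrite -setTT_bijective.
  exists (cls \o dec); split; first by apply/PsiP => G /=; rewrite eltK.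
  by move=> Psi /PsiP PE; apply/funext => x /=; rewrite -PE decK.
- move=> Psi /PsiP PE; case: eltB => _ _ eS; case: clsB => cF cI cS.
  split=> [x _|x y _ _|X /cS [G _ <-]].
  + by have [G _ <-] := eS x I; rewrite PE; exact: cF.
  + have [G _ <-] := eS x I; have [G' _ <-] := eS y I; rewrite !PE => E.
    by rewrite (cI G G') ?inE.
  + by exists (elt G).
Qed.
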